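(* Let $n\geq 2$ and $m$ be integers with $1\leq m\leq \binom{n}{2}$, and let $L(n,m)$ be the lex graph with $n$ vertices and $m$ edges, of depth $k$, with $p_k$ as defined below. Then for every integer $r>2$, the number $i_r$ of independent sets of size $r$ in $L(n,m)$ is $$i_r=\binom{n-k-p_k}{r-1}+\binom{n-k}{r}.$$
   Context: For $A,B\subset \mathbb{N}$, $A$ precedes $B$ in lexicographic order if $\min(A\triangle B)\in A$. The lex graph $L(n,m)$ is the graph with vertex set $[n]=\{1,\ldots,n\}$ whose edge set consists of the first $m$ elements of $\binom{[n]}{2}$ (2-element subsets of $[n]$) in lexicographic order, i.e. $\{1,2\},\{1,3\},\ldots,\{1,n\},\{2,3\},\ldots,\{2,n\},\{3,4\},\ldots$. For $1\leq m\leq\binom{n}{2}$ there is a unique sequence $p_1,\ldots,p_k$ with $\sum_{i=1}^k p_i=m$, $p_i>0$, $1\leq k\leq n-1$, $p_i=n-i$ for $i<k$, and $p_k\in\{1,\ldots,n-k\}$. The number $k$ is the depth of $L(n,m)$; equivalently, $k$ is the smallest element of $\{1,\ldots,n-1\}$ with $m\leq \frac{k(2n-k-1)}{2}$, and $p_k=m-\frac{(k-1)(2n-k)}{2}$. *)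

(* Defs.v *)
From mathcomp Require Import all_boot zify.

Set Implicit Arguments.
Unset Strict Implicit.
Unset Printing Implicit Defensive.

(* The vertex set [n] = {1, ..., n} is 'I_n = {0, ..., n-1}, with i : 'I_n      *)
(* standing for i + 1; the shift preserves the order.                          *)

Definition symdiff (T : finType) (A B : {set T}) : {set T} :=
  (A :\: B) :|: (B :\: A).

(* min (A symdiff B) exists and belongs to A. *)
Definition lex_precedes (n : nat) (A B : {set 'I_n}) : bool :=
  [exists x in symdiff A B,
     [forall y in symdiff A B, (x <= y)%N] && (x \in A)].

(* The reflexive closure, since sort expects a total (hence reflexive) relation. *)
Definition lex_le (n : nat) (A B : {set 'I_n}) : bool :=
  (A == B) || lex_precedes A B.

Definition pairs (n : nat) : {set {set 'I_n}} :=
  [set e : {set 'I_n} | #|e| == 2].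

Definition lex_edges (n m : nat) : {set {set 'I_n}} :=
  [set e in take m (sort (@lex_le n) (enum (pairs n)))].

(* The case x = y is harmless for sets E of 2-subsets: [set x; x] = [set x]. *)
Definition independent (T : finType) (E : {set {set T}}) (S : {set T}) : bool :=
  [forall x in S, forall y in S, [set x; y] \notin E].

Definition num_indep (T : finType) (E : {set {set T}}) (r : nat) : nat :=
  #|[set S : {set T} | independent E S & #|S| == r]|.

(* p = [:: p_1; ...; p_k], so p_i is nth 0 p i.-1, the depth k is size p and    *)
(* p_k is last 0 p. Truncated subtraction is harmless: i <= k <= n - 1.         *)
Definition lex_profile (n m : nat) (p : seq nat) : Prop :=
  [/\ 1 <= size p <= n - 1,
      sumn p = m,
      all (fun q => 0 < q) p,
      forall i, 1 <= i < size p -> nth 0 p i.-1 = n - i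
    & 1 <= last 0 p <= n - size p].

Lemma lex_profile_exists (n m : nat) :
  1 <= m <= 'C(n, 2) -> exists p, lex_profile n m p.
Proof.
elim: n m => [|n IHn] m; first by case: m.
case: (leqP m n) => [le_mn /andP[m0 _]|lt_nm].
  exists [:: m]; rewrite /lex_profile /= m0 subn1 /= addn0 le_mn.
  by split=> //; [exact: leq_trans le_mn | case=> [|[]]].
rewrite binS bin1 addnC => /andP[m0 le_m].
have /IHn[p [/andP[p0 pn] sp pp pi pl]] : 1 <= m - n <= 'C(n, 2).
  by rewrite subn_gt0 lt_nm leq_subLR.
have n1 : 0 < n.
  by case: n p0 pn {IHn lt_nm m0 le_m sp pi pl} => // p0; rewrite leqNgt p0.
exists (n :: p); rewrite /lex_profile /=.
have -> : last n p = last 0 p by case: (p) p0.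
rewrite n1 pp sp subnKC ?(ltnW lt_nm) // subn1 /= subSS pl; split=> //.
  by move: pn; rewrite subn1 -ltnS prednK.
case=> [//|[_|i]] /=; first by rewrite subn1.
by rewrite ltnS => lti; rewrite (pi i.+1) ?lti ?subSS.
Qed.

Lemma lex_profile_unique (n m : nat) (p q : seq nat) :
  lex_profile n m p -> lex_profile n m q -> p = q.
Proof.
have tail N M c d s : lex_profile N.+1 M [:: c, d & s] ->
    [/\ c = N, N < M & lex_profile N (M - N) (d :: s)].
  case=> /= sz sM /andP[_ ds] pi lst; have := pi 1 isT; rewrite /= => cN.
  split; [lia | lia | split=> /=; try by [lia | case/andP: ds => -> ->]].
  by case=> [//|i] /= lti; have := pi i.+2; rewrite subSS /=; apply.
elim: n m p q => [|n IHn] m [|a [|a' p]] [|b [|b' q]] hp hq;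
  try by [case: hp | case: hq].
- by case: hp hq => /= _ + _ _ _ [/= _ + _ _ _]; rewrite !addn0 => -> ->.
- by have [_ lt _] := tail _ _ _ _ _ hq; case: hp => /= *; lia.
- by have [_ lt _] := tail _ _ _ _ _ hp; case: hq => /= *; lia.
- have [-> _ hp'] := tail _ _ _ _ _ hp; have [-> _ hq'] := tail _ _ _ _ _ hq.
  by rewrite (IHn _ _ _ hp' hq').
Qed.

(* Main.v *)
Require Import Defs.
From mathcomp Require Import all_boot zify.

(** Write [v < w] for the endpoints of the [m]-th pair, so that [v] is the
    vertex [k] and [w] the vertex [k + p_k] of the paper.  The edges are the
    pairs lexicographically below [{v, w}].  Hence an independent set with at
    least two elements has no element below [v]; it either avoids [v], and is
    then an arbitrary set of vertices above [v], or consists of [v] and vertices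
    above [w]. *)

(** Agreement below [x] expresses that [x] is the minimum of the symmetric difference; in this form
    two first differences are easily compared. *)
Lemma lex_precedesP (n : nat) (A B : {set 'I_n}) :
  reflect (exists x, [/\ x \in A, x \notin B
                       & forall y : 'I_n, y < x -> (y \in A) = (y \in B)])
          (lex_precedes A B).
Proof.
apply: (iffP existsP) => -[x].
  case/and3P=> xAB /forallP xmin xA; exists x.
  move: xAB; rewrite !inE xA andbT /= orbF => xB; split=> // y ltyx.
  have := xmin y; rewrite !inE leqNgt ltyx /= implybF.
  by case: (y \in A); case: (y \in B).
case=> xA xB agree; exists x; rewrite !inE xA xB /= andbT.
apply/forallP => y; apply/implyP; rewrite !inE => yAB.
rewrite leqNgt; apply/negP => /agree Ey; move: yAB.
by rewrite Ey; case: (y \in B).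
Qed.

Lemma lex_le_trans (n : nat) : transitive (@lex_le n).
Proof.
move=> B A C /orP[/eqP->//|/[dup] leAB /lex_precedesP[x [xA xB agx]]].
case/orP=> [/eqP<-|/lex_precedesP[y [yB yC agy]]]; first by rewrite /lex_le leAB orbT.
apply/orP; right; apply/lex_precedesP.
(* The smaller of [x] and [y] is the first difference of [A] and [C]; they are distinct because only
   [y] lies in [B]. *)
have [ltxy|ltyx|/val_inj Exy] := ltngtP x y; last by rewrite -Exy (negPf xB) in yB.
  exists x; split; rewrite -?agy // => z ltzx.
  by rewrite agx // agy // (ltn_trans ltzx).
exists y; split; rewrite ?agx // => z ltzy.
by rewrite agx ?agy // (ltn_trans ltzy).
Qed.

Lemma lex_le_total (n : nat) : total (@lex_le n).
Proof.
move=> A B; have [->|neqAB] := eqVneq A B; first by rewrite /lex_le eqxx.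
have [x xAB] : exists x, (x \in A) != (x \in B).
  apply/existsP; apply: contraNT neqAB => /existsPn eqAB.
  by apply/eqP/setP=> x; apply/eqP; rewrite -[_ == _]negbK.
have [y yAB ymin] :=
  @arg_minnP _ x (fun z => (z \in A) != (z \in B)) (fun z : 'I_n => z : nat) xAB.
have agree (z : 'I_n) : z < y -> (z \in A) = (z \in B).
  by move=> ltzy; apply/eqP; apply: contraTT ltzy => /ymin; rewrite -leqNgt.
case yA: (y \in A) yAB; case yB: (y \in B) => // _.
  by apply/orP; left; apply/orP; right; apply/lex_precedesP; exists y; rewrite yA yB.
apply/orP; right; apply/orP; right; apply/lex_precedesP; exists y; rewrite yA yB.
by split=> // z /agree.
Qed.

Lemma lex_precedes_irr (n : nat) (A : {set 'I_n}) : ~~ lex_precedes A A.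
Proof. by apply/lex_precedesP => -[x [-> ]]. Qed.

(** The first difference is [i] if [i < a], and [j] if [i = a]. *)
Lemma lex_precedes_pair (n : nat) (i j a b : 'I_n) : i < j -> a < b ->
  (i < a) || (i == a) && (j < b) -> lex_precedes [set i; j] [set a; b].
Proof.
move=> ltij ltab /orP[ltia|/andP[/eqP Eia ltjb]]; apply/lex_precedesP.
  exists i; rewrite !inE eqxx -!val_eqE /=; split=> //; first by lia.
  by move=> y ltyi; rewrite !inE -!val_eqE /=; lia.
subst a; exists j; rewrite !inE eqxx orbT -!val_eqE /=; split=> //; first by lia.
by move=> y ltyi; rewrite !inE -!val_eqE /=; lia.
Qed.

Lemma lex_le_pair (n : nat) (i j a b : 'I_n) : i < j -> a < b ->
  lex_le [set i; j] [set a; b] = (i < a) || (i == a) && (j <= b).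
Proof.
move=> ltij ltab; apply/idP/idP => [le1|]; last first.
  case/orP=> [ltia|/andP[/eqP Eia]].
    by rewrite /lex_le lex_precedes_pair ?ltia ?orbT.
  rewrite leq_eqVlt => /orP[/eqP/val_inj Ejb|ltjb].
    by rewrite /lex_le Eia Ejb eqxx.
  by subst a; rewrite /lex_le lex_precedes_pair ?eqxx ?ltjb ?orbT.
(* If the right-hand side fails, the pairs are strictly ordered the other way, and the smaller of
   the two first differences contradicts the agreement below the larger. *)
apply: contraT => nle.
have lt2 : lex_precedes [set a; b] [set i; j].
  by apply: lex_precedes_pair => //; move: nle; rewrite -!val_eqE /=; lia.
case/orP: le1 => [/eqP E|lt1].
  by rewrite E (negPf (lex_precedes_irr _ _)) in lt2.
case/lex_precedesP: lt1 => x [xA xB agx]; case/lex_precedesP: lt2 => y [yA yB agy].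
case: (ltngtP x y) => [/agy|/agx|/val_inj Exy]; last by rewrite Exy yA in xB.
  by rewrite xA (negPf xB).
by rewrite yA (negPf yB).
Qed.

Lemma pairsP (n : nat) (e : {set 'I_n}) :
  reflect (exists i j : 'I_n, i < j /\ e = [set i; j]) (e \in pairs n).
Proof.
rewrite inE; apply: (iffP (@cards2P _ e)) => -[i [j []]]; last first.
  by move=> ltij ->; exists i, j; split; rewrite // -val_eqE /=; lia.
rewrite -val_eqE /= => neqij ->.
have [ltij|ltji|/eqP Eij] := ltngtP i j; last by rewrite Eij in neqij.
  by exists i, j.
by exists j, i; rewrite setUC.
Qed.

Lemma set2_inj_lt (n : nat) (i j a b : 'I_n) : i < j -> a < b ->
  [set i; j] = [set a; b] -> (i, j) = (a, b).
Proof.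
move=> ltij ltab /setP E.
have := E i; have := E j; have := E a; have := E b.
rewrite !inE !eqxx ?orbT -!val_eqE /= => *.
by congr pair; apply: val_inj => /=; lia.
Qed.

(** A downward closed predicate holds exactly on a prefix of a sorted list: once it fails, it fails
    at all later elements. *)
Lemma take_count_sorted (T : eqType) (leT : rel T) (a : pred T) (s : seq T) :
    transitive leT -> sorted leT s -> (forall x y, leT x y -> a y -> a x) ->
  take (count a s) s = filter a s.
Proof.
move=> leT_tr + a_down; elim: s => //= x s IHs; rewrite path_sortedE //.
case/andP=> /allP le_xs /IHs IH; have [_|ax] /= := boolP (a x); first by rewrite IH.
have na y : y \in s -> a y = false.
  by move=> /le_xs le_xy; apply/negP => /(a_down _ _ le_xy); apply/negP.
rewrite (eq_in_count (a2 := pred0)) // count_pred0 take0.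
by rewrite (eq_in_filter (a2 := pred0)) // filter_pred0.
Qed.

(** This eliminates [sort] and [take]: to identify the edges of a lex graph it remains to count the
    pairs up to a given one. *)
Lemma lex_edges_initial (n : nat) (e0 : {set 'I_n}) :
  lex_edges n #|[set e in pairs n | lex_le e e0]| =
  [set e in pairs n | lex_le e e0].
Proof.
set s := sort (@lex_le n) (enum (pairs n)).
have cnt : #|[set e in pairs n | lex_le e e0]| = count (fun e => lex_le e e0) s.
  rewrite cardE -size_filter; apply/perm_size/uniq_perm.
  - exact: enum_uniq.
  - by rewrite filter_uniq // sort_uniq enum_uniq.
  - by move=> e; rewrite mem_enum inE mem_filter mem_sort mem_enum andbC.
apply/setP => e; rewrite inE cnt (@take_count_sorted _ (@lex_le n)).
- by rewrite mem_filter mem_sort mem_enum !inE andbC.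
- exact: lex_le_trans.
- exact/sort_sorted/lex_le_total.
- by move=> x y; apply: lex_le_trans.
Qed.

Lemma card_ord_interval (n a b : nat) : b <= n ->
  #|[set j : 'I_n | a <= j < b]| = b - a.
Proof.
move=> lebn; rewrite -sum1dep_card big_mkcond /=.
rewrite -(big_mkord xpredT (fun j => if a <= j < b then 1 else 0)) -big_mkcond /=.
rewrite sum1_count -[b - a](size_iota a) -size_filter.
apply/perm_size/uniq_perm; rewrite ?filter_uniq ?iota_uniq // => j.
by rewrite mem_filter !mem_iota; lia.
Qed.

(** The pairs are counted by their smaller endpoint [i], so that the summands can be matched with
    the entries of the profile. *)
Lemma card_lex_initial (n : nat) (v w : 'I_n) : v < w ->
  #|[set e in pairs n | lex_le e [set v; w]]| =
  \sum_(i < n) #|[set j : 'I_n | i < j & (i < v) || (i == v) && (j <= w)]|.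
Proof.
move=> ltvw.
set D := [set q : 'I_n * 'I_n | q.1 < q.2 & (q.1 < v) || (q.1 == v) && (q.2 <= w)].
have -> : [set e in pairs n | lex_le e [set v; w]] = [set [set q.1; q.2] | q in D].
  apply/setP=> e; rewrite inE; apply/andP/imsetP.
    case=> /pairsP[i [j [ltij ->]]]; rewrite lex_le_pair // => le.
    by exists (i, j); rewrite // inE /= ltij.
  case=> -[i j]; rewrite inE /= => /andP[ltij le] ->.
  by rewrite lex_le_pair //; split=> //; apply/pairsP; exists i, j.
rewrite card_in_imset; last first.
  by move=> [i j] [a b]; rewrite !inE /= => /andP[? _] /andP[? _]; apply: set2_inj_lt.
rewrite -sum1dep_card; under [RHS]eq_bigr => i _ do rewrite -sum1dep_card.
by rewrite pair_big_dep.
Qed.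

Lemma lex_edgesE (n m : nat) (p : seq nat) (v w : 'I_n) :
    lex_profile n m p -> v.+1 = size p -> w.+1 = size p + last 0 p ->
  lex_edges n m = [set e in pairs n | lex_le e [set v; w]].
Proof.
case=> /andP[p0 pn] sump _ pE /andP[pk0 pkn] Ev Ew.
rewrite -lex_edges_initial card_lex_initial; last by lia.
congr lex_edges; rewrite -sump sumnE (big_nth 0) big_mkord.
(* The sum of the profile is padded with zeros up to [n] terms and then compared term by term. *)
rewrite (big_ord_widen n (nth 0 p)) ?big_mkcond /=; last by lia.
apply: eq_bigr => i _; case: ltnP => [lti|lei]; last first.
  rewrite (_ : [set _ | _] = set0) ?cards0 //.
  by apply/setP => j; rewrite !inE -val_eqE /=; lia.
(* A row [i < v] is full and has [n - i.+1] pairs; the row [i = v] stops at [w] and has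
   [w - v = last 0 p] pairs. *)
have [ltiv|leiv] := ltnP i v.
  rewrite (_ : [set _ | _] = [set j : 'I_n | i.+1 <= j < n]); last first.
    by apply/setP => j; rewrite !inE -val_eqE /=; have := ltn_ord j; lia.
  by rewrite card_ord_interval // -(pE i.+1) //; lia.
have Eiv : i = v by apply: val_inj => /=; lia.
rewrite (_ : [set _ | _] = [set j : 'I_n | i.+1 <= j < w.+1]); last first.
  by apply/setP => j; rewrite !inE Eiv eqxx /= ltnS; lia.
have -> : nth 0 p i = last 0 p by rewrite -nth_last -Ev Eiv.
by rewrite card_ord_interval // Eiv; lia.
Qed.

(** Increasing pairs suffice, since [[set i; j]] is symmetric and a singleton is not in [E]. *)
Lemma independent_pairsP (n : nat) (E : {set {set 'I_n}}) (S : {set 'I_n}) :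
    E \subset pairs n ->
  reflect (forall i j : 'I_n, i \in S -> j \in S -> i < j -> [set i; j] \notin E)
          (independent E S).
Proof.
move=> /subsetP sE; apply: (iffP forall_inP) => [ind i j iS jS _|ind i iS].
  exact: (forall_inP (ind i iS)).
apply/forall_inP => j jS.
have [ltij|ltji|/val_inj->] := ltngtP i j; first exact: ind.
  by rewrite setUC; apply: ind.
by apply/negP => /sE; rewrite inE setUid cards1.
Qed.

(** The bound on [#|S|] excludes singletons below [v], which are independent but of neither form. *)
Lemma independent_lex_initial (n : nat) (v w : 'I_n) (S : {set 'I_n}) :
    v < w -> 1 < #|S| ->
  independent [set e in pairs n | lex_le e [set v; w]] S =
  (S \subset [set j : 'I_n | v < j]) ||
  (v \in S) && (S :\ v \subset [set j : 'I_n | w < j]).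
Proof.
move=> ltvw S1; apply/independent_pairsP/idP => [|ind|].
- by apply/subsetP => e; rewrite inE => /andP[].
- have {}ind (i j : 'I_n) : i \in S -> j \in S -> i < j ->
      ~~ ((i < v) || (i == v) && (j <= w)).
    move=> iS jS ltij; have := ind i j iS jS ltij.
    rewrite inE lex_le_pair // (_ : _ \in pairs n = true) //.
    by apply/pairsP; exists i, j.
  (* A vertex below [v] is adjacent to every other vertex, and [S] has a second element. *)
  have ge_v (j : 'I_n) : j \in S -> v <= j.
    move=> jS; rewrite leqNgt; apply/negP => ltjv.
    have: 0 < #|S :\ j| by move: S1; rewrite (cardsD1 j) jS.
    case/card_gt0P=> i; rewrite !inE -val_eqE /= => /andP[neqij iS].
    have := ind i j iS jS; have := ind j i jS iS; rewrite ltjv /=.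
    by rewrite -!val_eqE /=; lia.
  case vS: (v \in S) => /=; apply/orP; [right|left]; apply/subsetP => j.
    rewrite !inE -val_eqE /= => /andP[neqjv jS].
    by have := ind v j vS jS; have := ge_v j jS; rewrite eqxx ltnn /=; lia.
  move=> jS; rewrite inE ltn_neqAle ge_v // andbT.
  by apply: contraFN vS => /eqP/val_inj->.
- move=> H i j iS jS ltij; rewrite inE lex_le_pair // negb_and; apply/orP; right.
  case/orP: H => [/subsetP H|/andP[vS /subsetP H]].
    by have := H i iS; rewrite inE -val_eqE /=; lia.
  have := H i; have := H j; rewrite !inE iS jS !andbT -!val_eqE /=; lia.
Qed.

Theorem theorem6 (n m : nat) (p : seq nat) (r : nat)
    (hn : 2 <= n) (hm : 1 <= m <= 'C(n, 2))
    (hp : lex_profile n m p) (hr : 2 < r) :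
  let k := size p in
  let pk := last 0 p in
  num_indep (lex_edges n m) r = 'C(n - k - pk, r - 1) + 'C(n - k, r).
Proof.
move=> k pk; have [/andP[k0 kn] _ _ _ /andP[pk0 pkn]] := hp.
rewrite -/k -/pk in k0 kn pk0 pkn.
(* Vertices are numbered from 0, hence the predecessors of [k] and [k + pk]. *)
have ltv : k.-1 < n by lia.
have ltw : (k + pk).-1 < n by lia.
pose v := Ordinal ltv; pose w := Ordinal ltw.
have ltvw : v < w by rewrite /=; lia.
rewrite (@lex_edgesE n m p v w) //=; [|lia|by rewrite -/k -/pk; lia].
pose above (u : 'I_n) := [set j : 'I_n | u < j].
have card_above (u : 'I_n) : #|above u| = n - u.+1.
  rewrite -(@card_ord_interval n) //; apply: eq_card => j.
  by rewrite !inE ltn_ord andbT.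
(* [F] gives the second binomial coefficient; [G] gives the first, its members being the independent
   sets through [v] with [v] removed. *)
pose F := [set S : {set 'I_n} | S \subset above v & #|S| == r].
pose G := [set S : {set 'I_n} | S \subset above w & #|S| == r - 1].
have notinG S : S \in G -> v \notin S.
  rewrite inE => /andP[/subsetP sS _]; apply/negP => /sS.
  by rewrite inE; lia.
have -> : num_indep [set e in pairs n | lex_le e [set v; w]] r
        = #|[set v |: S | S in G] :|: F|.
  apply: eq_card => S; rewrite !inE; have [/eqP cS|cS] := boolP (#|S| == r).
    rewrite !andbT independent_lex_initial ?cS ?(ltnW hr) // orbC; congr (_ || _).
    apply/andP/imsetP => [[vS sS]|[S' S'G ->]].
      exists (S :\ v); last by rewrite setD1K.
      by rewrite inE sS /= -cS (cardsD1 v S) vS add1n subn1.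
    rewrite setU11 setU1K ?notinG //; split=> //.
    by move: S'G; rewrite inE => /andP[].
  rewrite !andbF orbF; apply/esym/negP => /imsetP[S' S'G ES]; case/negP: cS.
  rewrite ES cardsU1 notinG //.
  by move: S'G; rewrite inE => /andP[_]; lia.
(* The two families are disjoint: [v] belongs to every set of the first and to none of the
   second. *)
rewrite cardsU (_ : _ :&: F = set0); last first.
  apply/setP => S; rewrite !inE; apply/negP => /and3P[/imsetP[S' _ ->]].
  by move=> /subsetP/(_ v); rewrite setU11 inE ltnn => /(_ isT).
rewrite cards0 subn0 card_in_imset; last first.
  move=> S T /notinG vS /notinG vT E.
  by rewrite -(setU1K vS) E setU1K.
rewrite !cards_draws !card_above /=; congr ('C(_, _) + 'C(_, _)); lia.
Qed.
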